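(* The $5$-cycle $C_5$ is strongly common, i.e. for every graphon $W$, \[t(C_5,W)+t(C_5,1-W)\geq t(K_2,W)^{5}+t(K_2,1-W)^{5}.\]
   Context: All graphs are finite and simple. A graphon is a measurable function $W:[0,1]^2\to[0,1]$ with $W(x,y)=W(y,x)$ for all $x,y$. For a graph $H$ and a graphon (or, more generally, a bounded symmetric measurable function) $U$, the homomorphism density is $t(H,U):=\int_{[0,1]^{V(H)}}\prod_{uv\in E(H)}U(x_u,x_v)\prod_{v\in V(H)}dx_v$. A graph $H$ with at least one edge is called strongly common if $t(H,W)+t(H,1-W)\geq t(K_2,W)^{e(H)}+t(K_2,1-W)^{e(H)}$ for every graphon $W$, where $e(H)$ is the number of edges of $H$. *)

(* Defs.v *)
From HB Require Import structures.
From mathcomp Require Import all_boot all_order all_algebra.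
From mathcomp Require Import all_classical all_reals all_analysis.

Set Implicit Arguments.
Unset Strict Implicit.
Unset Printing Implicit Defensive.
Import Order.TTheory GRing.Theory Num.Theory.

Local Open Scope classical_set_scope.
Local Open Scope ring_scope.

(* Finite simple graphs, with vertex set {0, ..., n-1}. *)
Record sgraph (n : nat) := SGraph {
  adj : rel 'I_n;
  adj_sym : symmetric adj;
  adj_irr : irreflexive adj
}.

(* An edge uv is represented by the ordered pair (u, v) with u < v. *)
Definition edges (n : nat) (H : sgraph n) : {set 'I_n * 'I_n} :=
  finset (fun uv : 'I_n * 'I_n => (uv.1 < uv.2)%N && adj H uv.1 uv.2).

Definition num_edges (n : nat) (H : sgraph n) : nat := #|edges H|.

Section complete_graph.
Variable n : nat.

Definition complete_adj : rel 'I_n := fun i j => i != j.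

Fact complete_adj_sym : symmetric complete_adj.
Proof. by move=> i j; rewrite /complete_adj eq_sym. Qed.

Fact complete_adj_irr : irreflexive complete_adj.
Proof. by move=> i; rewrite /complete_adj eqxx. Qed.

Definition complete_graph : sgraph n :=
  SGraph complete_adj_sym complete_adj_irr.
End complete_graph.

Section cycle_graph.
Variable n : nat.

(* This is the cycle of length n for n >= 3 only. *)
Definition cycle_adj : rel 'I_n :=
  fun i j => (i != j) && ((i.+1 %% n == j)%N || (j.+1 %% n == i)%N).

Fact cycle_adj_sym : symmetric cycle_adj.
Proof. by move=> i j; rewrite /cycle_adj eq_sym orbC. Qed.

Fact cycle_adj_irr : irreflexive cycle_adj.
Proof. by move=> i; rewrite /cycle_adj eqxx. Qed.

Definition cycle_graph : sgraph n := SGraph cycle_adj_sym cycle_adj_irr.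
End cycle_graph.

Definition K2 : sgraph 2 := complete_graph 2.
Definition C5 : sgraph 5 := cycle_graph 5.

Lemma num_edges_C5 : num_edges C5 = 5%N.
Proof.
rewrite /num_edges -sum1_card big_mkcond /=.
under eq_bigr do rewrite inE.
rewrite -(pair_bigA _ (fun i j : 'I_5 =>
  if (i < j)%N && adj C5 i j then 1 else 0)%N) /=.
by do !rewrite big_ord_recl ?big_ord0.
Qed.

(* Lebesgue measure on R^n (as n-tuples of reals), by recursion on n: it is the
   image of the product of the Lebesgue measures on R and on R^(n-1) under the
   bijection R x R^(n-1) -> R^n. *)
Section tuple_lebesgue_measure.
Context {R : realType}.
Local Notation T := (measurableTypeR R).

Definition tuple_cons (n : nat) (p : T * n.-tuple T) : n.+1.-tuple T :=
  [the n.+1.-tuple T of p.1 :: p.2].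

Lemma measurable_tuple_cons (n : nat) :
  measurable_fun [set: T * n.-tuple T] (@tuple_cons n).
Proof. exact: (measurable_cons measurable_fst measurable_snd). Qed.

Section step.
Variables (n : nat) (m : {sigma_finite_measure set (n.-tuple T) -> \bar R}).

Definition lebesgue_cons : set (n.+1.-tuple T) -> \bar R :=
  pushforward (lebesgue_measure \x m)%E (@tuple_cons n).

Let lebesgue_cons0 : lebesgue_cons set0 = 0%E.
Proof. by rewrite /lebesgue_cons /pushforward preimage_set0 measure0. Qed.

Let lebesgue_cons_ge0 A : (0 <= lebesgue_cons A)%E.
Proof. by rewrite /lebesgue_cons /pushforward measure_ge0. Qed.

Let lebesgue_cons_sigma_additive : semi_sigma_additive lebesgue_cons.
Proof.
move=> F mF tF mUF; rewrite /lebesgue_cons /pushforward preimage_bigcup.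
apply: measure_semi_sigma_additive.
- by move=> k; rewrite -[X in measurable X]setTI; exact: measurable_tuple_cons.
- apply/trivIsetP => /= i j _ _ ij; rewrite -preimage_setI.
  by move/trivIsetP : tF => /(_ _ _ _ _ ij) ->//; rewrite preimage_set0.
- by rewrite -preimage_bigcup -[X in measurable X]setTI;
    exact: measurable_tuple_cons.
Qed.

HB.instance Definition _ := isMeasure.Build _ _ _ lebesgue_cons
  lebesgue_cons0 lebesgue_cons_ge0 lebesgue_cons_sigma_additive.

Let lebesgue_cons_sigma_finite : sigma_finite setT lebesgue_cons.
Proof.
pose l : {sigma_finite_measure set T -> \bar R} := lebesgue_measure.
have /sigma_finiteP[F [TF ndF Foo]] := sigma_finiteT l.
have /sigma_finiteP[G [TG ndG Goo]] := sigma_finiteT m.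
pose g (t : n.+1.-tuple T) : T * n.-tuple T := (thead t, [tuple of behead t]).
have gK p : g (tuple_cons p) = p.
  by case: p => x t; congr pair; apply: val_inj.
have mg : measurable_fun setT g.
  apply/measurable_fun_pairP; split; first exact: measurable_tnth.
  exact: measurable_behead.
exists (fun k => g @^-1` (F k `*` G k)).
  rewrite -preimage_bigcup (_ : \bigcup_i _ = setT) ?preimage_setT//.
  rewrite -setXTT TF TG predeqE => -[x y]; split.
    by move=> [k _ []/= ? ?]; split; exists k.
  move=> [/= [i _ Fix] [k _ Gky]]; exists (maxn i k) => //; split.
  - by move: x Fix; exact/subsetPset/ndF/leq_maxl.
  - by move: y Gky; exact/subsetPset/ndG/leq_maxr.
move=> k; have [? ?] := Foo k; have [? ?] := Goo k; split.
  by rewrite -[X in measurable X]setTI; apply: mg => //; exact: measurableX.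
rewrite /lebesgue_cons /pushforward -comp_preimage.
rewrite (_ : g \o _ = id) ?preimage_id; last exact/funext.
by rewrite product_measure1E// lte_mul_pinfty// ge0_fin_numE.
Qed.

HB.instance Definition _ := Measure_isSigmaFinite.Build _ _ _ lebesgue_cons
  lebesgue_cons_sigma_finite.

End step.

Fixpoint tuple_lebesgue (n : nat) :
    {sigma_finite_measure set (n.-tuple T) -> \bar R} :=
  match n with
  | 0 => \d_([tuple] : 0.-tuple T)
  | k.+1 => lebesgue_cons (tuple_lebesgue k)
  end.

End tuple_lebesgue_measure.
Arguments tuple_lebesgue R n : clear implicits.

Section homomorphism_density.
Context {R : realType}.
Local Notation T := (measurableTypeR R).

Definition unit_interval : set T := `[0%R, 1%R]%classic.

Definition unit_cube (n : nat) : set (n.-tuple T) :=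
  [set x | forall i, tnth x i \in `[0, 1]%R].
Arguments unit_cube n : clear implicits.

Definition hom_density (n : nat) (H : sgraph n) (U : T -> T -> R) : R :=
  \int[tuple_lebesgue R n]_(x in unit_cube n)
     \prod_(uv in edges H) U (tnth x uv.1) (tnth x uv.2).

(* A graphon is a function on [0, 1]^2: all conditions are restricted to the
   unit square, and hom_density does not depend on values outside it.
   Measurability is with respect to the Borel sigma-algebras. *)
Definition is_graphon (W : T -> T -> R) : Prop :=
  [/\ measurable_fun (unit_interval `*` unit_interval)
        (fun xy : T * T => W xy.1 xy.2),
      {in `[0, 1]%R &, forall x y, W x y = W y x} &
      {in `[0, 1]%R &, forall x y, 0 <= W x y <= 1}].

Definition compl_graphon (W : T -> T -> R) : T -> T -> R :=
  fun x y => 1 - W x y.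

End homomorphism_density.

Definition strongly_common (R : realType) (n : nat) (H : sgraph n) : Prop :=
  (0 < num_edges H)%N /\
  forall W : measurableTypeR R -> measurableTypeR R -> R, is_graphon W ->
    hom_density H W + hom_density H (compl_graphon W) >=
    hom_density K2 W ^+ num_edges H +
    hom_density K2 (compl_graphon W) ^+ num_edges H.

(* Main.v *)
(** Write W = p + U with p the edge density, so that U has mean 0 and
1 - W = q - U with q = 1 - p. Expanding the product over the edges of C_5, the
terms whose edge set contains an isolated edge vanish, the terms t(C_5, U) and
t(C_5, -U) cancel, and the remaining ones are densities of paths with 2, 3 and
4 edges. With f(x) = int U(x, y) dy and g(x) = int U(x, y) f(y) dy the
difference of the two sides is therefore
  5 int ((p^3 + q^3) f^2 + (p^2 - q^2) f g + g^2),
and the quadratic form is nonnegative because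
(p - q)^2 <= 1 <= 4 (1 - 3 p q) = 4 (p^3 + q^3). *)

Require Import Defs.
From mathcomp Require Import all_boot all_order all_algebra.
From mathcomp Require Import all_classical all_reals all_analysis.
From mathcomp Require Import measurable_realfun ring lra.

Set Implicit Arguments.
Unset Strict Implicit.
Unset Printing Implicit Defensive.
Import Order.TTheory GRing.Theory Num.Theory.

Local Open Scope classical_set_scope.
Local Open Scope ring_scope.

(** * Bounded measurable real functions and their means under a probability measure *)

Section bounded_measurable.
Context {R : realType}.

(** This class is closed under sums, products and partial integration, and all its members are
    integrable for a probability measure. A single syntactic check therefore discharges every side
    condition of linearity and Fubini. *)
Definition bmeas (d : measure_display) (T : measurableType d) (f : T -> R) :=
  measurable_fun setT f /\ exists M, forall x, `|f x| <= M.

Definition bmeas2 (d1 d2 : measure_display) (T1 : measurableType d1)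
    (T2 : measurableType d2) (U : T1 -> T2 -> R) :=
  bmeas (fun z : T1 * T2 => U z.1 z.2).

Section closure.
Context {d : measure_display} {T : measurableType d}.
Implicit Types f g : T -> R.

Lemma bmeas_cst (c : R) : bmeas (fun _ : T => c).
Proof. by split; [exact: measurable_cst | exists `|c|]. Qed.

Lemma bmeasD f g : bmeas f -> bmeas g -> bmeas (fun x => f x + g x).
Proof.
move=> [mf [M fM]] [mg [N gN]]; split; first exact: measurable_funD.
by exists (M + N) => x; rewrite (le_trans (ler_normD _ _))// lerD.
Qed.

Lemma bmeasM f g : bmeas f -> bmeas g -> bmeas (fun x => f x * g x).
Proof.
move=> [mf [M fM]] [mg [N gN]]; split; first exact: measurable_funM.
by exists (M * N) => x; rewrite normrM ler_pM.
Qed.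

Lemma bmeasN f : bmeas f -> bmeas (fun x => - f x).
Proof.
move=> [mf [M fM]]; split; first exact: measurableT_comp.
by exists M => x; rewrite normrN.
Qed.

Lemma bmeas_comp (d' : measure_display) (T' : measurableType d') (g : T' -> R)
    (h : T -> T') :
  bmeas g -> measurable_fun setT h -> bmeas (fun x => g (h x)).
Proof.
move=> [mg [M gM]] mh; split; first exact: (measurableT_comp mg mh).
by exists M.
Qed.

Variable P : probability T R.

Lemma bmeas_integrable f : bmeas f -> P.-integrable setT (EFin \o f).
Proof.
move=> [mf [M fM]]; apply: measurable_bounded_integrable => //.
  by rewrite /= probability_setT ltry.
by exists M; split;
  [exact: num_real | move=> N /ltW MN x _; exact: le_trans MN].
Qed.

Lemma bmeas_integralE f : bmeas f ->
  (\int[P]_x (f x)%:E)%E = (\int[P]_x f x)%:E.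
Proof.
by move=> /bmeas_integrable fi; rewrite fineK//; exact: integrable_fin_num.
Qed.

Lemma meanD f g : bmeas f -> bmeas g ->
  \int[P]_x (f x + g x) = \int[P]_x f x + \int[P]_x g x.
Proof. by move=> bf bg; rewrite RintegralD//; exact: bmeas_integrable. Qed.

Lemma meanZ c f : bmeas f -> \int[P]_x (c * f x) = c * \int[P]_x f x.
Proof. by move=> bf; rewrite RintegralZl//; exact: bmeas_integrable. Qed.

(** Keeping the values [a] and [b] as separate equations lets repeated [apply] peel a long linear
    combination term by term, each mean being supplied on its own. *)
Lemma mean_combine c f g a b : bmeas f -> bmeas g ->
  \int[P]_x f x = a -> \int[P]_x g x = b ->
  \int[P]_x (f x + c * g x) = a + c * b.
Proof.
by move=> bf bg <- <-; rewrite meanD// ?meanZ//; exact/bmeasM/bg/bmeas_cst.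
Qed.

Lemma mean_cst c : \int[P]_x c = c.
Proof.
by rewrite Rintegral_cst//= probability_setT/= mulr1.
Qed.

Lemma mean_norm_le f M : bmeas f -> (forall x, `|f x| <= M) ->
  `|\int[P]_x f x| <= M.
Proof.
move=> bf fM; have bM := @bmeas_cst M.
have -> : M = \int[P]_x M by rewrite mean_cst.
apply: (le_trans (le_normr_Rintegral _ (bmeas_integrable bf))) => //.
apply: le_Rintegral => //; last exact: bmeas_integrable.
by apply: bmeas_integrable; case: bf => mf [N fN]; split;
  [exact: measurableT_comp | exists N => x; rewrite normr_id].
Qed.

End closure.

(** Tonelli gives measurability of the partial integral of a nonnegative function. The bound [M]
    makes [M + G] nonnegative, and subtracting the constant [M] afterwards recovers the partial
    integral of [G]. *)
Lemma bmeas_mean (d1 d2 : measure_display) (T1 : measurableType d1)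
    (T2 : measurableType d2) (P2 : probability T2 R) (G : T1 -> T2 -> R) :
  bmeas2 G -> bmeas (fun x => \int[P2]_y G x y).
Proof.
move=> bG; have [_ [M GM]] := bG.
have sG x : bmeas (G x).
  by apply: (bmeas_comp (h := fun y => (x, y)) bG);
    apply: measurable_fun_pair; [exact: measurable_cst | exact: measurable_id].
split; last by exists M => x; apply: mean_norm_le => // y; exact: (GM (x, y)).
pose H (z : T1 * T2) := M + G z.1 z.2.
have bH : bmeas H by apply: bmeasD => //; exact: bmeas_cst.
have H0 z : (0 <= (H z)%:E)%E.
  by rewrite lee_fin /H; have := GM z; rewrite ler_norml => /andP[]; lra.
have -> : (fun x => \int[P2]_y G x y) =
    (fun x => fine (fubini_F P2 (EFin \o H) x) + - M).
  apply/funext => x; rewrite /fubini_F /H /=.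
  rewrite -[fine _]/(\int[P2]_y (M + G x y)).
  by rewrite meanD ?mean_cst//; [ring | exact: bmeas_cst].
apply: measurable_funD; last exact: measurable_cst.
apply: measurableT_comp; first exact: fine_measurable.
apply: measurable_fun_fubini_tonelli_F => //.
by apply/measurable_EFinP; case: bH.
Qed.

Lemma mean_swap (d1 d2 : measure_display) (T1 : measurableType d1)
    (T2 : measurableType d2) (P1 : probability T1 R) (P2 : probability T2 R)
    (G : T1 -> T2 -> R) : bmeas2 G ->
  \int[P1]_x \int[P2]_y G x y = \int[P2]_y \int[P1]_x G x y.
Proof.
move=> bG.
have s1 x : bmeas (G x).
  by apply: (bmeas_comp (h := fun y => (x, y)) bG);
    apply: measurable_fun_pair; [exact: measurable_cst | exact: measurable_id].
have s2 y : bmeas (G^~ y).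
  by apply: (bmeas_comp (h := fun x => (x, y)) bG);
    apply: measurable_fun_pair; [exact: measurable_id | exact: measurable_cst].
have bG' : bmeas2 (fun y x => G x y).
  by apply: (bmeas_comp (h := fun z => (z.2, z.1)) bG);
    apply: measurable_fun_pair; [exact: measurable_snd | exact: measurable_fst].
have := Fubini (bmeas_integrable (P1 \x P2)%E bG).
under eq_integral do rewrite /= bmeas_integralE//.
under [in RHS]eq_integral do rewrite /= bmeas_integralE//.
rewrite !bmeas_integralE; first by case.
- exact: (bmeas_mean P1 (G := fun y x => G x y)).
- exact: bmeas_mean.
Qed.

End bounded_measurable.

(** * Automation for bounded measurability *)

Ltac measurable_proj := first
  [ exact: measurable_id | exact: measurable_cst
  | exact: measurable_fst | exact: measurable_snd
  | apply: measurable_fun_pair; measurable_proj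
  | apply: (measurableT_comp measurable_fst); measurable_proj
  | apply: (measurableT_comp measurable_snd); measurable_proj ].

Lemma bmeas_comp2 (R : realType) (d d' : measure_display) (T : measurableType d)
    (S : measurableType d') (U : T -> T -> R) (a b : S -> T) :
  bmeas2 U ->
  measurable_fun setT a -> measurable_fun setT b ->
  bmeas (fun s => U (a s) (b s)).
Proof.
move=> bU ma mb; apply: (bmeas_comp (h := fun s => (a s, b s)) bU).
exact: measurable_fun_pair.
Qed.

(** The recursion follows the arithmetic shape of the function; hypotheses on families, functions
    and kernels close the leaves. A goal matching no other clause is taken to be an integral over a
    second variable. *)
Ltac bmeas_tac :=
  match goal with
  | |- bmeas (fun _ => ?c) => exact: bmeas_cst
  | |- bmeas (fun s => @?f s + @?g s) =>
      refine (@bmeasD _ _ _ f g _ _); bmeas_tac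
  | |- bmeas (fun s => @?f s * @?g s) =>
      refine (@bmeasM _ _ _ f g _ _); bmeas_tac
  | |- bmeas (fun s => - @?f s) => refine (@bmeasN _ _ _ f _); bmeas_tac
  | H : forall k, bmeas (?v k) |- bmeas (?v ?k) => exact: (H k)
  | H : forall k, bmeas (?v k) |- bmeas (fun s => ?v ?k (@?h s)) =>
      refine (bmeas_comp (h := h) (H k) _); measurable_proj
  | H : bmeas ?v |- bmeas ?v => exact: H
  | H : bmeas ?v |- bmeas (fun s => ?v (@?h s)) =>
      refine (bmeas_comp (h := h) H _); measurable_proj
  | H : bmeas2 ?U |- bmeas (fun s => ?U (@?a s) (@?b s)) =>
      refine (bmeas_comp2 (a := a) (b := b) H _ _); measurable_proj
  | H : bmeas2 ?U |- bmeas (?U ?x) =>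
      refine (bmeas_comp2 (a := fun=> x) (b := id) H _ _); measurable_proj
  | |- _ => apply: bmeas_mean; rewrite /bmeas2; bmeas_tac
  end.

(** * Integral operators, walks and the five-cycle trace *)

Section five_cycle.
Context {R : realType} {d : measure_display} {T : measurableType d}.
Variable P : probability T R.
Implicit Types (U V : T -> T -> R) (v w : T -> R).

Definition int_op U v : T -> R := fun x => \int[P]_y (U x y * v y).

(** The trace of the fifth power of the integral operator with kernel [V]: the section [V^~ x]
    accounts for the edge closing the cycle at [x], the four operators for the other edges. *)
Definition cycle5_trace V : R :=
  \int[P]_x int_op V (int_op V (int_op V (int_op V (V^~ x)))) x.

Section kernel.
Variable U : T -> T -> R.
Hypothesis bU : bmeas2 U.
Hypothesis symU : forall x y, U x y = U y x.

Lemma bmeas_int_op v : bmeas v -> bmeas (int_op U v).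
Proof. by move=> bv; rewrite /int_op; bmeas_tac. Qed.

Lemma bmeas_int_op2 (d' : measure_display) (S : measurableType d')
    (F : S -> T -> R) :
  bmeas2 F ->
  bmeas2 (fun s => int_op U (F s)).
Proof.
move=> bF; rewrite /bmeas2 /int_op.
apply: (bmeas_mean P (G := fun z y => U z.2 y * F z.1 y)); apply: bmeasM.
  by bmeas_tac.
apply: (bmeas_comp (h := fun z => (z.1.1, z.2)) bF); measurable_proj.
Qed.

Lemma int_opD v w x : bmeas v -> bmeas w ->
  int_op U (fun y => v y + w y) x = int_op U v x + int_op U w x.
Proof.
move=> bv bw; rewrite /int_op -meanD; [|bmeas_tac..].
by apply: eq_Rintegral => y _; rewrite mulrDr.
Qed.

Lemma int_opZ c v x : bmeas v ->
  int_op U (fun y => c * v y) x = c * int_op U v x.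
Proof.
move=> bv; rewrite /int_op -meanZ; [|bmeas_tac].
by apply: eq_Rintegral => y _; rewrite mulrCA.
Qed.

Lemma int_op_combine c v w a b x : bmeas v -> bmeas w ->
  int_op U v x = a -> int_op U w x = b ->
  int_op U (fun y => v y + c * w y) x = a + c * b.
Proof.
by move=> bv bw <- <-; rewrite int_opD// ?int_opZ//; exact/bmeasM/bw/bmeas_cst.
Qed.

(** Self-adjointness of the operator: Fubini exchanges the variables and [symU] restores the
    kernel. *)
Lemma int_op_adjoint v w : bmeas v -> bmeas w ->
  \int[P]_x (v x * int_op U w x) = \int[P]_x (int_op U v x * w x).
Proof.
move=> bv bw; rewrite /int_op.
transitivity (\int[P]_x \int[P]_y (v x * (U x y * w y))).
  by apply: eq_Rintegral => x _; rewrite -meanZ//; bmeas_tac.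
rewrite mean_swap; [|rewrite /bmeas2; bmeas_tac].
apply: eq_Rintegral => y _; rewrite [RHS]mulrC -meanZ; [|bmeas_tac].
by apply: eq_Rintegral => x _; rewrite symU mulrCA mulrA mulrC mulrCA mulrA.
Qed.

(** The constant part of the kernel acts by averaging. The relevant signs are [e = 1] for a graphon
    and [e = -1] for its complement. *)
Lemma int_op_affine p e v x : bmeas v ->
  int_op (fun x y => p + e * U x y) v x =
  p * (\int[P]_y v y) + e * int_op U v x.
Proof.
move=> bv; rewrite /int_op -!meanZ -?meanD; [|bmeas_tac..].
by apply: eq_Rintegral => y _; rewrite mulrDl mulrA.
Qed.

(** Walks with [k] edges from a given point, weighted by [U]. Thus [walk 1] and [walk 2] are f and g
    of the opening sketch, and [path_density k] is the density in [U] of the path with [k] edges. *)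
Definition walk (k : nat) : T -> R := iter k (int_op U) (fun=> 1).
Definition path_density (k : nat) : R := \int[P]_x walk k x.

Lemma bmeas_walk k : bmeas (walk k).
Proof. by elim: k => [|k ih]; [exact: bmeas_cst | exact: bmeas_int_op]. Qed.

(** Two walks from a common point form a path with [i + j] edges; self-adjointness moves the
    operators from one factor to the other one at a time. *)
Lemma mean_walkM i j :
  \int[P]_x (walk i x * walk j x) = path_density (i + j).
Proof.
elim: i j => [|i ih] j.
  by apply: eq_Rintegral => x _; rewrite mul1r.
rewrite -int_op_adjoint; [|exact: bmeas_walk..].
by rewrite -[int_op _ _]/(walk j.+1) ih addnS.
Qed.

(* Abstracting the values keeps [ring] from comparing them by unfolding. *)
Local Ltac ring_walks := repeat match goal with
  | |- context [walk ?k ?z] => generalize (walk k z); intro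
  | |- context [path_density ?k] => generalize (path_density k); intro
  | |- context [iter ?k ?f ?v ?z] => generalize (iter k f v z); intro
  end; ring.

Lemma bmeas_iter_int_op k v : bmeas v -> bmeas (iter k (int_op U) v).
Proof. by move=> bv; elim: k => //= k ih; exact: bmeas_int_op. Qed.

Lemma mean_walkM_iter i k v : bmeas v ->
  \int[P]_x (walk i x * iter k (int_op U) v x) =
  \int[P]_x (walk (i + k) x * v x).
Proof.
move=> bv; elim: k i => [|k ih] i; first by rewrite addn0.
rewrite iterS int_op_adjoint; [|exact: bmeas_walk|exact: bmeas_iter_int_op].
by rewrite -[int_op U (walk i)]/(walk i.+1) ih addSnnS.
Qed.

Lemma mean_iter_section k y :
  \int[P]_x iter k (int_op U) (U^~ y) x = walk k.+1 y.
Proof.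
have bu : bmeas (U^~ y) by bmeas_tac.
transitivity (\int[P]_x (walk 0 x * iter k (int_op U) (U^~ y) x)).
  by apply: eq_Rintegral => x _; rewrite mul1r.
rewrite mean_walkM_iter// [RHS]/walk iterS.
by apply: eq_Rintegral => x _; rewrite mulrC symU.
Qed.

(** Restricting to the diagonal requires joint measurability in the section parameter and the point,
    so the induction is carried out on [bmeas2]. *)
Lemma bmeas_iter_diagonal k : bmeas (fun x => iter k (int_op U) (U^~ x) x).
Proof.
suff b2 : bmeas2 (fun x => iter k (int_op U) (U^~ x)).
  by apply: (bmeas_comp2 b2); exact: measurable_id.
elim: k => [|k ih] /=; first by rewrite /bmeas2; bmeas_tac.
exact: bmeas_int_op2.
Qed.

Let int_op_cst c x : int_op U (fun=> c) x = c * walk 1 x.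
Proof.
rewrite -[walk 1 x]/(int_op U (walk 0) x) -int_opZ; last exact: bmeas_walk.
by apply: eq_Rintegral => z _; rewrite mulr1.
Qed.

Local Opaque walk path_density.

Let mean_combination c0 c1 c2 c3 c v : bmeas v ->
  \int[P]_z (c0 + c1 * walk 1 z + c2 * walk 2 z + c3 * walk 3 z
             + c * v z) =
  c0 + c1 * path_density 1 + c2 * path_density 2 + c3 * path_density 3
  + c * \int[P]_z v z.
Proof.
move=> bv; have bD := bmeas_walk.
by do 4![apply: mean_combine => //; try by bmeas_tac]; exact: mean_cst.
Qed.

Let int_op_combination c0 c1 c2 c3 c v x : bmeas v ->
  int_op U (fun z => c0 + c1 * walk 1 z + c2 * walk 2 z + c3 * walk 3 z
                     + c * v z) x =
  c0 * walk 1 x + c1 * walk 2 x + c2 * walk 3 x + c3 * walk 4 x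
    + c * int_op U v x.
Proof.
move=> bv; have bD := bmeas_walk.
by do 4![apply: int_op_combine => //; try by bmeas_tac]; exact: int_op_cst.
Qed.

(** One application of the affine kernel keeps the shape of the combination: the constant part
    yields [p] times the mean, while [U] lengthens each walk and the iterated section by one edge.
    Repeated application thus only updates coefficients. *)
Let affine_step p e c0 c1 c2 c3 c k y :
  int_op (fun x y => p + e * U x y)
    (fun z => c0 + c1 * walk 1 z + c2 * walk 2 z + c3 * walk 3 z
              + c * iter k (int_op U) (U^~ y) z) =
  (fun x => p * (c0 + c1 * path_density 1 + c2 * path_density 2
                 + c3 * path_density 3 + c * walk k.+1 y)
     + e * c0 * walk 1 x + e * c1 * walk 2 x + e * c2 * walk 3 x
     + e * c3 * walk 4 x + e * c * iter k.+1 (int_op U) (U^~ y) x).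
Proof.
apply/funext => x; have bD := bmeas_walk.
have bu : bmeas (iter k (int_op U) (U^~ y)).
  by apply: bmeas_iter_int_op; bmeas_tac.
rewrite int_op_affine; last by bmeas_tac.
rewrite mean_combination// int_op_combination// mean_iter_section.
rewrite -[int_op U (iter _ _ _)]/(iter k.+1 _ _).
by ring_walks.
Qed.

(** Each factor 5 counts the rotations of a path with 2, 3 or 4 edges inside the cycle; every other
    proper nonempty edge set has an isolated edge and contributes a factor [path_density 1]. The
    proof composes the operators instead of enumerating edge sets. *)
Lemma cycle5_trace_affine p e : path_density 1 = 0 ->
  cycle5_trace (fun x y => p + e * U x y) =
  p ^+ 5 + 5 * p ^+ 3 * e ^+ 2 * path_density 2
  + 5 * p ^+ 2 * e ^+ 3 * path_density 3
  + 5 * p * e ^+ 4 * path_density 4 + e ^+ 5 * cycle5_trace U.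
Proof.
move=> m1; have bD := bmeas_walk; have bu := bmeas_iter_diagonal 4.
set V := fun x y => _.
(* The zero coefficients pad the section to the shape required by [affine_step]. That of [walk 3]
   stays zero until [F4], so [walk 4] at [z] appears only in the last application. *)
have F1 y : V^~ y = fun z => p + 0 * walk 1 z + 0 * walk 2 z
    + 0 * walk 3 z + e * iter 0 (int_op U) (U^~ y) z.
  apply/funext => z; rewrite /V -[U z y]/(iter 0 (int_op U) (U^~ y) z).
  by ring_walks.
(* [c1], [c2] and [c3] are the means over [z] of the right-hand sides of [F1], [F2] and [F3],
   simplified by [m1]; averaging by the constant part of [V] turns them into the next constant
   terms. *)
pose c1 y := p + e * walk 1 y.
pose c2 y := p * c1 y + e ^+ 2 * walk 2 y.
pose c3 y := p * c2 y + e ^+ 2 * p * path_density 2 + e ^+ 3 * walk 3 y.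
have F2 y : int_op V (V^~ y) = fun z => p * c1 y + e * p * walk 1 z
    + 0 * walk 2 z + 0 * walk 3 z
    + e ^+ 2 * iter 1 (int_op U) (U^~ y) z.
  by rewrite F1 affine_step m1; apply/funext => z; rewrite /c1; ring_walks.
have F3 y : int_op V (int_op V (V^~ y)) = fun z => p * c2 y
    + e * p * c1 y * walk 1 z + e ^+ 2 * p * walk 2 z + 0 * walk 3 z
    + e ^+ 3 * iter 2 (int_op U) (U^~ y) z.
  by rewrite F2 affine_step m1; apply/funext => z; rewrite /c2; ring_walks.
have F4 y : int_op V (int_op V (int_op V (V^~ y))) = fun z => p * c3 y
    + e * p * c2 y * walk 1 z + e ^+ 2 * p * c1 y * walk 2 z
    + e ^+ 3 * p * walk 3 z + e ^+ 4 * iter 3 (int_op U) (U^~ y) z.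
  by rewrite F3 affine_step m1; apply/funext => z; rewrite /c3; ring_walks.
(* The fourth application evaluated at [z = y]: products of two walks arise where a coefficient
   depending on [y] multiplies a walk at [z]. *)
transitivity (\int[P]_y (
    p * (p ^+ 4 + 2 * e ^+ 2 * p ^+ 2 * path_density 2
         + e ^+ 3 * p * path_density 3)
    + 2 * (p ^+ 4 * e + p ^+ 2 * e ^+ 3 * path_density 2) * walk 1 y
    + 2 * p ^+ 3 * e ^+ 2 * walk 2 y + 2 * p ^+ 2 * e ^+ 3 * walk 3 y
    + 2 * p * e ^+ 4 * walk 4 y
    + p ^+ 3 * e ^+ 2 * (walk 1 y * walk 1 y)
    + 2 * p ^+ 2 * e ^+ 3 * (walk 1 y * walk 2 y)
    + 2 * p * e ^+ 4 * (walk 1 y * walk 3 y)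
    + p * e ^+ 4 * (walk 2 y * walk 2 y)
    + e ^+ 5 * iter 4 (int_op U) (U^~ y) y)).
  apply: eq_Rintegral => y _; rewrite F4 affine_step m1 /c3 /c2 /c1.
  by ring_walks.
rewrite (_ : \int[P]_y _ =
    p * (p ^+ 4 + 2 * e ^+ 2 * p ^+ 2 * path_density 2
         + e ^+ 3 * p * path_density 3)
    + 2 * (p ^+ 4 * e + p ^+ 2 * e ^+ 3 * path_density 2) * path_density 1
    + 2 * p ^+ 3 * e ^+ 2 * path_density 2
    + 2 * p ^+ 2 * e ^+ 3 * path_density 3
    + 2 * p * e ^+ 4 * path_density 4 + p ^+ 3 * e ^+ 2 * path_density 2
    + 2 * p ^+ 2 * e ^+ 3 * path_density 3 + 2 * p * e ^+ 4 * path_density 4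
    + p * e ^+ 4 * path_density 4 + e ^+ 5 * cycle5_trace U); last first.
  (* Terms are peeled from the right: the cycle, the four products of walks, the four single walks,
     then the constant. *)
  apply: mean_combine; [by bmeas_tac | by bmeas_tac | | exact: erefl].
  do 4![apply: mean_combine; [by bmeas_tac | by bmeas_tac | |
    exact: mean_walkM]].
  do 4![apply: mean_combine; [by bmeas_tac | by bmeas_tac | | by []]].
  exact: mean_cst.
rewrite m1.
by generalize (cycle5_trace U); intro; ring_walks.
Qed.

(** By [mean_walkM] the three densities are the integrals of f^2, f g and g^2, and the discriminant
    condition makes the quadratic form pointwise nonnegative by completing the square. *)
Lemma path_density_quadratic_form a b : b ^+ 2 <= 4 * a ->
  0 <= a * path_density 2 + b * path_density 3 + path_density 4.
Proof.
move=> ab; have bD := bmeas_walk.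
have -> : a * path_density 2 + b * path_density 3 + path_density 4 =
    \int[P]_x (a * (walk 1 x * walk 1 x) + b * (walk 1 x * walk 2 x)
               + walk 2 x * walk 2 x).
  by rewrite !meanD ?meanZ ?mean_walkM; [|bmeas_tac..].
apply: Rintegral_ge0 => x _.
set f := walk 1 x; set g := walk 2 x.
have -> : a * (f * f) + b * (f * g) + g * g =
  (g + b / 2 * f) ^+ 2 + (4 * a - b ^+ 2) / 4 * f ^+ 2 by field.
by rewrite addr_ge0 ?sqr_ge0// mulr_ge0 ?sqr_ge0// divr_ge0 ?subr_ge0.
Qed.

End kernel.

Lemma cycle5_trace_strongly_common V p : bmeas2 V ->
  (forall x y, V x y = V y x) -> \int[P]_x \int[P]_y V x y = p ->
  p ^+ 5 + (1 - p) ^+ 5 <=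
  cycle5_trace V + cycle5_trace (fun x y => 1 - V x y).
Proof.
move=> bV symV pE; pose U x y := V x y - p.
have bU : bmeas2 U by rewrite /bmeas2 /U; bmeas_tac.
have symU x y : U x y = U y x by rewrite /U symV.
have m1 : path_density U 1 = 0.
  rewrite /path_density /walk /= /int_op.
  transitivity (\int[P]_x (\int[P]_y V x y + - p)).
    apply: eq_Rintegral => x _; under eq_Rintegral do rewrite mulr1.
    by rewrite meanD ?mean_cst//; bmeas_tac.
  by rewrite meanD ?mean_cst ?pE ?subrr//; bmeas_tac.
have -> : V = fun x y => p + 1 * U x y.
  by apply/funext => x; apply/funext => y; rewrite /U; ring.
have -> : (fun x y => 1 - (p + 1 * U x y)) = fun x y => (1 - p) + -1 * U x y.
  by apply/funext => x; apply/funext => y; ring.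
rewrite !cycle5_trace_affine//.
(* With q = 1 - p, these coefficients are p^3 + q^3 = 1 - 3 p q and p^2 - q^2 = p - q = 2 p - 1. *)
have := @path_density_quadratic_form U bU symU
  (1 - 3 * p * (1 - p)) (2 * p - 1).
set m2 := path_density U 2; set m3 := path_density U 3.
set m4 := path_density U 4 => m0.
(* Here 4 a - b^2 = 1 + 2 (2 p - 1)^2. *)
have {}m0 := m0 ltac:(by have := sqr_ge0 (2 * p - 1); nra).
rewrite -subr_ge0 (_ : _ - _ =
  5 * ((1 - 3 * p * (1 - p)) * m2 + (2 * p - 1) * m3 + m4)); last by ring.
by rewrite mulr_ge0.
Qed.

End five_cycle.

(** * Homomorphism densities as iterated integrals over the unit interval *)

Section tuple_integration.
Context {R : realType}.
Local Notation T := (measurableTypeR R).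
Local Notation uniform01 := (uniform_prob (@ltr01 R)).

Lemma measurable_unit_cube (n : nat) : measurable (@unit_cube R n).
Proof.
have -> : @unit_cube R n =
    \bigcap_(i in [set: 'I_n]) ((fun t => tnth t i) @^-1` `[0, 1]).
  by apply/seteqP; split => [t tI i _|t tI i]; [exact: tI | exact: tI i I].
apply: fin_bigcap_measurable => [|i _]; first exact: finite_finset.
by rewrite -[X in measurable X]setTI; exact: measurable_tnth.
Qed.

Lemma unit_cube_cons (n : nat) (x : T) (t : n.-tuple T) :
  unit_cube (tuple_cons (x, t)) = (`[0, 1]%classic x /\ unit_cube t) :> Prop.
Proof.
apply/propext; split => [xtI|[xI tI] i].
  split; first exact: (xtI ord0).
  by move=> i; have := xtI (lift ord0 i); rewrite (tnth_nth 0) /= -tnth_nth.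
case: (unliftP ord0 i) => [j ->|->]; last exact: xI.
by rewrite (tnth_nth 0) /= -tnth_nth; exact: tI.
Qed.

Lemma integral_unit_cube0 (F : 0.-tuple T -> R) :
  (\int[tuple_lebesgue R 0]_(t in @unit_cube R 0) (F t)%:E)%E =
  (F [tuple])%:E.
Proof.
rewrite (_ : @unit_cube R 0 = setT); last by apply/seteqP; split => // t _ [].
rewrite (_ : (fun t => (F t)%:E) = cst (F [tuple])%:E); last first.
  by apply/funext => t; rewrite tuple0.
rewrite integral_dirac//.
by rewrite diracT mul1e.
Qed.

(** The measure on tuples is the image of a product, so Tonelli splits off the first coordinate.
    Using the uniform probability for that coordinate makes the results on means applicable. *)
Lemma integral_unit_cubeS (n : nat) (F : n.+1.-tuple T -> R) :
  measurable_fun setT F -> (forall t, 0 <= F t) ->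
  (\int[tuple_lebesgue R n.+1]_(t in @unit_cube R n.+1) (F t)%:E =
   \int[uniform01]_x \int[tuple_lebesgue R n]_(t in @unit_cube R n)
     (F (tuple_cons (x, t)))%:E)%E.
Proof.
move=> mF F0; pose f (z : T * n.-tuple T) := (F (tuple_cons z))%:E.
have mf : measurable_fun setT f.
  apply/measurable_EFinP.
  exact: (measurableT_comp mF (@measurable_tuple_cons _ _)).
have mcube := @measurable_unit_cube.
(* [D] constrains only the tail, so that the inner integral is measurable on the whole line, as
   [integral_uniform] requires; [E] below constrains all coordinates. *)
pose D := [set: T] `*` @unit_cube R n.
have mD : measurable D by exact: measurableX.
have mfD : measurable_fun setT (f \_ D).
  by apply/(measurable_restrictT _ mD); exact: measurable_funTS.
have f0 E z : (0 <= (f \_ E) z)%E.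
  by apply: erestrict_ge0 => y _; rewrite lee_fin.
have GE x : (\int[tuple_lebesgue R n]_(t in @unit_cube R n) f (x, t) =
    fubini_F (tuple_lebesgue R n) (f \_ D) x)%E.
  rewrite integral_mkcond /fubini_F; apply: eq_integral => t _.
  rewrite !patchE; congr (if _ then _ else _).
  by apply/idP/idP; rewrite !inE /D /setX /=; [|case].
rewrite [RHS]integral_uniform; last 2 first.
- rewrite (eq_fun GE).
  exact: measurable_fun_fubini_tonelli_F.
- by move=> x; apply: integral_ge0 => t _; rewrite lee_fin.
rewrite subr0 invr1 mul1e.
rewrite [LHS](@ge0_integral_pushforward _ _ _ _ _ _ (@measurable_tuple_cons _ _)
  (lebesgue_measure \x tuple_lebesgue R n)%E) //=; last 3 first.
- exact: mcube.
- by apply/measurable_EFinP; exact: measurable_funTS.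
- by move=> t _; rewrite lee_fin.
set E := _ @^-1` _.
have mE : measurable E.
  rewrite -[X in measurable X]setTI; apply: measurable_tuple_cons => //.
  exact: mcube.
rewrite [LHS]integral_mkcond -/f.
have mfE : measurable_fun setT (f \_ E).
  by apply/(measurable_restrictT _ mE); exact: measurable_funTS.
transitivity (\int[lebesgue_measure]_x
    fubini_F (tuple_lebesgue R n) (f \_ E) x)%E.
  exact: (fubini_tonelli1 _ mfE (f0 E)).
rewrite [RHS]integral_mkcond; apply: eq_integral => x _.
rewrite [RHS]patchE /fubini_F; case: ifPn => xI.
  rewrite [RHS]integral_mkcond; apply: eq_integral => t _.
  rewrite !patchE; congr (if _ then _ else _); move: xI.
  by rewrite !inE => xI; apply/idP/idP; rewrite !inE /E /= unit_cube_cons;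
    [case | split].
rewrite integral0_eq// => t _; rewrite patchE ifF//; apply/negbTE; move: xI.
by apply: contra; rewrite !inE /E /= unit_cube_cons => -[].
Qed.


Definition edge_product (n : nat) (H : sgraph n) (V : T -> T -> R)
    (t : n.-tuple T) : R :=
  \prod_(uv in edges H) V (tnth t uv.1) (tnth t uv.2).

Lemma measurable_edge_product (n : nat) (H : sgraph n) (V : T -> T -> R) :
  bmeas2 V -> measurable_fun setT (edge_product H V).
Proof.
move=> bV; rewrite /edge_product.
under eq_fun do rewrite -big_enum.
apply: measurable_prod => -[i j] _ /=.
by have [] := bmeas_comp2 bV (@measurable_tnth _ T n i)
  (@measurable_tnth _ T n j).
Qed.

Lemma edge_product_ge0 (n : nat) (H : sgraph n) (V : T -> T -> R) t :
  (forall x y, 0 <= V x y) -> 0 <= edge_product H V t.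
Proof. by move=> V0; apply: prodr_ge0. Qed.

Lemma edge_productE (n : nat) (H : sgraph n) (V : T -> T -> R) t :
  edge_product H V t = \prod_(i < n) \prod_(j < n)
    if (i < j)%N && adj H i j then V (tnth t i) (tnth t j) else 1.
Proof.
rewrite /edge_product big_mkcond pair_bigA /=.
by apply: eq_bigr => ij _; rewrite inE.
Qed.

Local Ltac expand_edge_product :=
  rewrite edge_productE !big_ord_recl !big_ord0;
  (* The edge tests on concrete ordinals are closed booleans, decided here by computation. *)
  repeat match goal with |- context [if ?b then _ else _] =>
    let b' := eval vm_compute in b in change b with b' end;
  rewrite !(mul1r, mulr1).

Lemma edge_product_C5 (V : T -> T -> R) x0 x1 x2 x3 x4 :
  edge_product C5 V (tuple_cons (x0, tuple_cons (x1, tuple_cons (x2,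
    tuple_cons (x3, tuple_cons (x4, [tuple])))))) =
  V x0 x1 * V x0 x4 * V x1 x2 * V x2 x3 * V x3 x4.
Proof.
by expand_edge_product; rewrite ?mulrA.
Qed.

Lemma edge_product_K2 (V : T -> T -> R) x0 x1 :
  edge_product K2 V (tuple_cons (x0, tuple_cons (x1, [tuple]))) = V x0 x1.
Proof.
by expand_edge_product; rewrite ?mulrA.
Qed.

(** One step of iterated integration: [c] collects the edges between earlier vertices, and the
    integrated vertex is absorbed into an operator. *)
Lemma integral_mul_int_op (V : T -> T -> R) c v x : bmeas2 V -> bmeas v ->
  (\int[uniform01]_y (c * (V x y * v y))%:E =
   (c * int_op uniform01 V v x)%:E)%E.
Proof.
move=> bV bv; rewrite bmeas_integralE; last by bmeas_tac.
by rewrite meanZ//; bmeas_tac.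
Qed.

(** The vertices are integrated from the last to the first; each of the four inner integrals becomes
    one operator, and [x0] remains as the variable of the trace. *)
Lemma hom_density_C5 (V : T -> T -> R) : bmeas2 V ->
  (forall x y, 0 <= V x y) -> (forall x y, V x y = V y x) ->
  hom_density C5 V = cycle5_trace uniform01 V.
Proof.
move=> bV V0 symV.
have mF := @measurable_edge_product 5 C5 V bV.
have F0 t : 0 <= edge_product C5 V t by exact: edge_product_ge0.
have mcons n x : measurable_fun setT (fun t : n.-tuple T => tuple_cons (x, t)).
  apply: (measurableT_comp (@measurable_tuple_cons _ _)).
  by apply: measurable_fun_pair; [exact: measurable_cst|exact: measurable_id].
have b1 x : bmeas (V^~ x) by bmeas_tac.
have bop v : bmeas v -> bmeas (int_op uniform01 V v) by exact: bmeas_int_op.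
rewrite -[LHS]/(fine (\int[_]_(t in _) (edge_product C5 V t)%:E)%E).
rewrite integral_unit_cubeS//.
under eq_integral => x0 _.
  rewrite integral_unit_cubeS//; last exact: (measurableT_comp mF (mcons _ _)).
  under eq_integral => x1 _.
    rewrite integral_unit_cubeS//; last first.
      apply: (measurableT_comp mF); apply: (measurableT_comp (mcons _ _)).
      exact: mcons.
    under eq_integral => x2 _.
      rewrite integral_unit_cubeS//; last first.
        apply: (measurableT_comp mF); apply: (measurableT_comp (mcons _ _)).
        apply: (measurableT_comp (mcons _ _)); exact: mcons.
      under eq_integral => x3 _.
        rewrite integral_unit_cubeS//; last first.
          apply: (measurableT_comp mF); apply: (measurableT_comp (mcons _ _)).
          apply: (measurableT_comp (mcons _ _)).
          apply: (measurableT_comp (mcons _ _)); exact: mcons.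
        under eq_integral => x4 _.
          rewrite integral_unit_cube0 edge_product_C5.
          (* The edges are ordered along the cycle, and the closing edge is reversed so that it
             reads as the section [V^~ x0] at [x4]. *)
          rewrite (_ : _ * _ = (V x0 x1 * V x1 x2 * V x2 x3) *
            (V x3 x4 * V x4 x0)); last by rewrite (symV x4); ring.
          over.
        rewrite integral_mul_int_op// -mulrA.
        over.
      rewrite integral_mul_int_op//; last exact: bop.
      rewrite -mulrA.
      over.
    rewrite integral_mul_int_op//; last exact/bop/bop.
    over.
  rewrite bmeas_integralE; last first.
    by apply: bmeasM; [bmeas_tac | exact/bop/bop/bop].
  over.
by rewrite [X in fine X](bmeas_integralE _
  (bmeas_iter_diagonal uniform01 bV 4)).
Qed.

Lemma hom_density_K2 (V : T -> T -> R) : bmeas2 V ->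
  (forall x y, 0 <= V x y) ->
  hom_density K2 V = \int[uniform01]_x \int[uniform01]_y V x y.
Proof.
move=> bV V0.
have mF := @measurable_edge_product 2 K2 V bV.
have F0 t : 0 <= edge_product K2 V t by exact: edge_product_ge0.
have mcons n x : measurable_fun setT (fun t : n.-tuple T => tuple_cons (x, t)).
  apply: (measurableT_comp (@measurable_tuple_cons _ _)).
  by apply: measurable_fun_pair; [exact: measurable_cst|exact: measurable_id].
rewrite -[LHS]/(fine (\int[_]_(t in _) (edge_product K2 V t)%:E)%E).
rewrite integral_unit_cubeS//.
under eq_integral => x0 _.
  rewrite integral_unit_cubeS//; last exact: (measurableT_comp mF (mcons _ _)).
  under eq_integral do rewrite integral_unit_cube0 edge_product_K2.
  rewrite bmeas_integralE; last by bmeas_tac.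
  over.
by rewrite bmeas_integralE//; bmeas_tac.
Qed.

End tuple_integration.

(** * Passage from graphons on the unit square to kernels on the whole plane *)

Lemma eq_hom_density (R : realType) (n : nat) (H : sgraph n)
    (U V : measurableTypeR R -> measurableTypeR R -> R) :
  {in `[0, 1] &, forall x y, U x y = V x y} ->
  hom_density H U = hom_density H V.
Proof.
move=> UV; apply: eq_Rintegral => t; rewrite inE => tI.
by apply: eq_bigr => uv _; exact: UV.
Qed.

Theorem theorem1p2 (R : realType) : strongly_common R C5.
Proof.
split; rewrite num_edges_C5 // => W [mW symW W01].
pose I01 : set (measurableTypeR R) := unit_interval.
(* A graphon is controlled only on the unit square; extension by 0 makes it symmetric, bounded and
   measurable everywhere without changing any density. *)
pose V x y := if (x \in I01) && (y \in I01) then W x y else 0.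
have VE x y : V x y = if (x \in `[0, 1]) && (y \in `[0, 1]) then W x y else 0.
  by rewrite /V !mem_setE.
have symV x y : V x y = V y x.
  by rewrite !VE andbC; case: ifPn => // /andP[? ?]; exact: symW.
have V01 x y : 0 <= V x y <= 1.
  by rewrite VE; case: ifPn => [/andP[? ?]|_];
    [exact: W01 | rewrite lexx ler01].
have bV : bmeas2 V.
  split; last first.
    by exists 1 => z; have /andP[V0 V1] := V01 z.1 z.2; rewrite ger0_norm.
  have mI : measurable (I01 `*` I01).
    by apply: measurableX; exact: measurable_itv.
  pose b (z : measurableTypeR R * measurableTypeR R) :=
    (z.1 \in I01) && (z.2 \in I01).
  have bE : b @^-1` [set true] = I01 `*` I01.
    apply/seteqP; split => -[x y] /=; rewrite /b /=.
      by case/andP; rewrite !inE.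
    by case=> xI yI; rewrite !mem_set.
  apply: (@measurable_fun_if _ _ _ _ _ _ _ _ b) => //.
  - by apply: (measurable_fun_bool true); rewrite setTI bE.
  - by rewrite setTI bE.
have VW : {in `[0, 1] &, forall x y, W x y = V x y}.
  by move=> x y xI yI; rewrite VE xI yI.
have VW' : {in `[0, 1] &, forall x y, compl_graphon W x y = 1 - V x y}.
  by move=> x y xI yI; rewrite /compl_graphon VW.
rewrite !(eq_hom_density _ VW) !(eq_hom_density _ VW').
have V0 x y : 0 <= V x y by case/andP: (V01 x y).
have V1 x y : 0 <= 1 - V x y by rewrite subr_ge0; case/andP: (V01 x y).
have bV' : bmeas2 (fun x y => 1 - V x y) by rewrite /bmeas2; bmeas_tac.
rewrite !hom_density_C5// => [|x y]; last by rewrite symV.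
rewrite !hom_density_K2//.
set p := \int[_]_x \int[_]_y V x y.
have -> : \int[uniform_prob (@ltr01 R)]_x \int[uniform_prob (@ltr01 R)]_y
    (1 - V x y) = 1 - p.
  transitivity (\int[uniform_prob (@ltr01 R)]_x
      (1 + -1 * \int[uniform_prob (@ltr01 R)]_y V x y)).
    apply: eq_Rintegral => x _.
    under eq_Rintegral do rewrite -[- V _ _]mulN1r.
    by apply: mean_combine; rewrite ?mean_cst//; bmeas_tac.
  by rewrite -[- p]mulN1r; apply: mean_combine; rewrite ?mean_cst//; bmeas_tac.
exact: cycle5_trace_strongly_common.
Qed.
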